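(* Let $K\subset\mathbb R^m$ be a smooth cone and $h:\mathbb R^n\to\mathbb R^m$ a continuously differentiable $K$-concave function, and let $S=\{x\in\mathbb R^n:h(x)\in K\}$ be nonempty. Then the inclusion $h(x)\in K$ has a local error bound at $\bar x\in S$ if and only if there exists a neighborhood $U$ of $\bar x$ such that $\mathrm{ACQ}(S\cap U)$ holds, i.e. $$h'(x)^*[N_K(h(x))]=N_S(x)\quad\text{for all }x\in S\cap U.$$
   Context: $h$ is $K$-concave if $h((1-\lambda)x+\lambda y)-[(1-\lambda)h(x)+\lambda h(y)]\in K$ for all $x,y$, $\lambda\in[0,1]$. $h'(x)^*$ is the adjoint of the Jacobian. $N_D(x)$ is the normal cone of a convex set $D$ at $x$. The inclusion has a local error bound at $\bar x\in S$ if there exist a neighborhood $U$ of $\bar x$ and $\alpha>0$ with $d(x,S)\le\alpha\, d(h(x),K)$ for all $x\in U$, where $d(x,D)=\inf_{y\in D}\|x-y\|$. A cone is regular if pointed, closed, convex, with nonempty interior. A regular cone $C$ is smooth if every boundary point of $C$ lies on an extreme ray of $C$ (a ray $\{\lambda x:\lambda\ge0\}$, $x\ne0$, which is a face of $C$, a face being a convex $\mathcal F\subset C$ such that $x,y\in C$, $\lambda x+(1-\lambda)y\in\mathcal F$ for some $0<\lambda<1$ implies $x,y\in\mathcal F$) and, for every non-zero point $x$ of any extreme ray, $N_C(x)$ has dimension one. *)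

(* Defs.v *)
From HB Require Import structures.
From mathcomp Require Import all_boot all_order all_algebra.
From mathcomp Require Import all_classical all_reals all_analysis.
Set Implicit Arguments. Unset Strict Implicit. Unset Printing Implicit Defensive.
Import Order.TTheory GRing.Theory Num.Theory.
Import numFieldNormedType.Exports.
Local Open Scope classical_set_scope.
Local Open Scope ring_scope.

Section Defs.
Variable R : realType.

Definition dotv k (u v : 'rV[R]_k) : R := \sum_(i < k) u ord0 i * v ord0 i.
Definition euclid k (u : 'rV[R]_k) : R := Num.sqrt (dotv u u).

Definition dist_set k (x : 'rV[R]_k) (D : set 'rV[R]_k) : R :=
  inf [set euclid (x - y) | y in D].

Definition normal_cone k (D : set 'rV[R]_k) (x : 'rV[R]_k) : set 'rV[R]_k :=
  [set v | forall y, D y -> dotv v (y - x) <= 0].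

Definition convex_set k (D : set 'rV[R]_k) : Prop :=
  forall x y (l : R), D x -> D y -> 0 <= l <= 1 -> D ((1 - l) *: x + l *: y).

Definition is_cone k (C : set 'rV[R]_k) : Prop :=
  forall x (l : R), C x -> 0 <= l -> C (l *: x).

Definition pointed k (C : set 'rV[R]_k) : Prop :=
  forall x, C x -> C (- x) -> x = 0.

Definition regular_cone k (C : set 'rV[R]_k) : Prop :=
  [/\ is_cone C, pointed C, closed C, convex_set C & C° !=set0].

Definition is_face k (C F : set 'rV[R]_k) : Prop :=
  [/\ convex_set F, F `<=` C &
     forall x y (l : R), C x -> C y -> 0 < l < 1 -> F (l *: x + (1 - l) *: y) ->
       F x /\ F y].

Definition ray k (x : 'rV[R]_k) : set 'rV[R]_k :=
  [set l *: x | l in [set l : R | 0 <= l]].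

Definition extreme_ray k (C : set 'rV[R]_k) (x : 'rV[R]_k) : Prop :=
  x != 0 /\ is_face C (ray x).

(* a cone D (containing 0) has dimension one: its linear span is a line *)
Definition dim_one k (D : set 'rV[R]_k) : Prop :=
  exists v, [/\ v != 0, D v & forall w, D w -> exists c : R, w = c *: v].

Definition smooth_cone k (C : set 'rV[R]_k) : Prop :=
  [/\ regular_cone C,
      (forall z, (closure C `\` C°) z -> exists x, extreme_ray C x /\ ray x z) &
      (forall x z, extreme_ray C x -> ray x z -> z != 0 -> dim_one (normal_cone C z))].

Definition K_concave n m (K : set 'rV[R]_m) (h : 'rV[R]_n -> 'rV[R]_m) : Prop :=
  forall x y (l : R), 0 <= l <= 1 ->
    K (h ((1 - l) *: x + l *: y) - ((1 - l) *: h x + l *: h y)).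

Definition C1 n m (h : 'rV[R]_n -> 'rV[R]_m) : Prop :=
  (forall x, differentiable h x) /\ continuous (fun x => jacobian h x).

(* adjoint of the Jacobian h'(x)^*; with row vectors, h'(x) v = v *m 'J h x *)
Definition jac_adj n m (h : 'rV[R]_n -> 'rV[R]_m) (x : 'rV[R]_n) (w : 'rV[R]_m)
  : 'rV[R]_n := w *m (jacobian h x)^T.

Definition local_error_bound n m (h : 'rV[R]_n -> 'rV[R]_m) (K : set 'rV[R]_m)
  (xb : 'rV[R]_n) : Prop :=
  exists U, nbhs xb U /\ exists alpha : R, 0 < alpha /\
    forall x, U x -> dist_set x (h @^-1` K) <= alpha * dist_set (h x) K.

Definition ACQ_on n m (h : 'rV[R]_n -> 'rV[R]_m) (K : set 'rV[R]_m)
  (U : set 'rV[R]_n) : Prop :=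
  forall x, (h @^-1` K `&` U) x ->
    jac_adj h x @` normal_cone K (h x) = normal_cone (h @^-1` K) x.

End Defs.

(* Main.v *)
Require Import Defs.
From HB Require Import structures.
From mathcomp Require Import all_boot all_order all_algebra.
From mathcomp Require Import all_classical all_reals all_analysis.
From mathcomp Require Import ring lra.
Import Order.TTheory GRing.Theory Num.Theory.
Import numFieldNormedType.Exports.
Local Open Scope classical_set_scope.
Local Open Scope ring_scope.
Set Implicit Arguments. Unset Strict Implicit. Unset Printing Implicit Defensive.

(** Both conditions are equivalent to a uniform version of ACQ: near [xb], every
    normal [v] to [S] at [x] in [S] is [h'(x)^* w] for some normal [w] to [K] at
    [h x] with [|w| <= tau |v|].

    Uniform ACQ gives the error bound by projecting [u] onto [S]: the residual
    [u - p] is normal, and the gradient inequality of K-concavity bounds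
    [|u - p|^2 = <w, h'(p)(u - p)>] by [<w, h u>].  The error bound gives ACQ by
    comparing support functions, the distance to [K] being the support function
    of the unit ball of the polar cone.

    Smoothness is needed to get uniformity out of ACQ.  If no nonzero normal of
    [K] at [h xb] is killed by [h'(xb)^*], compactness of the sphere suffices.
    Otherwise, if [h xb <> 0], the normals of [K] there lie on a line, so [S] has
    only trivial normals near [xb].  If [h xb = 0], the killed normal [k]
    stays normal and killed at all points of [S], and the closedness of
    [N_S(x) = h'(x)^*(K polar)] forces [N_S(x)] to be a ray or a subspace: [K]
    and its polar have only rays as proper faces.  Both shapes are stable near
    [xb], and give uniform constants. *)

(** * Euclidean inner product and norm *)

Lemma dotvC {R : realType} {k : nat} (u v : 'rV[R]_k) : dotv u v = dotv v u.
Proof. by apply: eq_bigr => i _; rewrite mulrC. Qed.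

Lemma dotvDl {R : realType} {k : nat} (u v w : 'rV[R]_k) :
  dotv (u + v) w = dotv u w + dotv v w.
Proof.
by rewrite /dotv -big_split; apply: eq_bigr => i _; rewrite mxE mulrDl.
Qed.

Lemma dotvZl {R : realType} {k : nat} (a : R) (u v : 'rV[R]_k) :
  dotv (a *: u) v = a * dotv u v.
Proof.
by rewrite /dotv mulr_sumr; apply: eq_bigr => i _; rewrite mxE mulrA.
Qed.

Lemma dotvNl {R : realType} {k : nat} (u v : 'rV[R]_k) :
  dotv (- u) v = - dotv u v.
Proof. by rewrite -scaleN1r dotvZl mulN1r. Qed.

Lemma dotvBl {R : realType} {k : nat} (u v w : 'rV[R]_k) :
  dotv (u - v) w = dotv u w - dotv v w.
Proof. by rewrite dotvDl dotvNl. Qed.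

Lemma dotvDr {R : realType} {k : nat} (u v w : 'rV[R]_k) :
  dotv u (v + w) = dotv u v + dotv u w.
Proof. by rewrite dotvC dotvDl !(dotvC u). Qed.

Lemma dotvZr {R : realType} {k : nat} (a : R) (u v : 'rV[R]_k) :
  dotv u (a *: v) = a * dotv u v.
Proof. by rewrite dotvC dotvZl dotvC. Qed.

Lemma dotvNr {R : realType} {k : nat} (u v : 'rV[R]_k) :
  dotv u (- v) = - dotv u v.
Proof. by rewrite dotvC dotvNl dotvC. Qed.

Lemma dotvBr {R : realType} {k : nat} (u v w : 'rV[R]_k) :
  dotv u (v - w) = dotv u v - dotv u w.
Proof. by rewrite dotvC dotvBl !(dotvC u). Qed.

Lemma dotv0l {R : realType} {k : nat} (u : 'rV[R]_k) : dotv 0 u = 0.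
Proof. by rewrite -(scale0r u) dotvZl mul0r. Qed.

Lemma dotv0r {R : realType} {k : nat} (u : 'rV[R]_k) : dotv u 0 = 0.
Proof. by rewrite dotvC dotv0l. Qed.

Definition dotvE := (@dotvDl, @dotvDr, @dotvNl, @dotvNr, @dotvZl, @dotvZr,
  @dotv0l, @dotv0r).

Lemma dotv_ge0 {R : realType} {k : nat} (u : 'rV[R]_k) : 0 <= dotv u u.
Proof. by apply: sumr_ge0 => i _; rewrite -expr2 sqr_ge0. Qed.

Lemma sqr_coord_le_dotv {R : realType} {k : nat} (u : 'rV[R]_k) (i : 'I_k) :
  u ord0 i ^+ 2 <= dotv u u.
Proof.
rewrite /dotv (bigD1 i)//= -expr2 lerDl.
by apply: sumr_ge0 => j _; rewrite -expr2 sqr_ge0.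
Qed.

Lemma dotv_eq0 {R : realType} {k : nat} (u : 'rV[R]_k) : dotv u u = 0 -> u = 0.
Proof.
move=> u0; apply/rowP => i; rewrite mxE; apply/eqP; rewrite -sqrf_eq0.
by apply/eqP/le_anti; rewrite sqr_ge0 andbT -u0 sqr_coord_le_dotv.
Qed.

Lemma dotv_gt0 {R : realType} {k : nat} (u : 'rV[R]_k) :
  u != 0 -> 0 < dotv u u.
Proof.
by move=> u0; rewrite lt_def dotv_ge0 andbT; apply: contra_neq u0; apply: dotv_eq0.
Qed.

Lemma dotv_sqrBZ {R : realType} {k : nat} (u v : 'rV[R]_k) (l : R) :
  dotv (u - l *: v) (u - l *: v) =
  dotv u u - 2 * l * dotv u v + l ^+ 2 * dotv v v.
Proof. by rewrite !dotvE (dotvC v u); ring. Qed.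

Lemma euclid_ge0 {R : realType} {k : nat} (u : 'rV[R]_k) : 0 <= euclid u.
Proof. exact: sqrtr_ge0. Qed.

Lemma sqr_euclid {R : realType} {k : nat} (u : 'rV[R]_k) :
  euclid u ^+ 2 = dotv u u.
Proof. by rewrite sqr_sqrtr// dotv_ge0. Qed.

Lemma euclid0 {R : realType} {k : nat} : euclid (0 : 'rV[R]_k) = 0.
Proof. by rewrite /euclid dotv0l sqrtr0. Qed.

Lemma euclid_gt0 {R : realType} {k : nat} (u : 'rV[R]_k) :
  u != 0 -> 0 < euclid u.
Proof. by move=> u0; rewrite sqrtr_gt0 dotv_gt0. Qed.

Lemma euclidZ {R : realType} {k : nat} (a : R) (u : 'rV[R]_k) :
  0 <= a -> euclid (a *: u) = a * euclid u.
Proof.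
move=> a0; rewrite /euclid dotvZl dotvZr mulrA -expr2.
by rewrite sqrtrM ?sqr_ge0// sqrtr_sqr ger0_norm.
Qed.

Lemma euclidN {R : realType} {k : nat} (u : 'rV[R]_k) : euclid (- u) = euclid u.
Proof. by rewrite /euclid dotvNl dotvC dotvNl opprK. Qed.

Lemma cauchy_schwarz {R : realType} {k : nat} (u v : 'rV[R]_k) :
  dotv u v <= euclid u * euclid v.
Proof.
have [->|v0] := eqVneq v 0; first by rewrite dotv0r euclid0 mulr0.
have [->|u0] := eqVneq u 0; first by rewrite dotv0l euclid0 mul0r.
have a0 := euclid_gt0 u0; have b0 := euclid_gt0 v0.
(* This square expands to [2 |u| |v| (|u| |v| - <u, v>)]. *)
have := dotv_ge0 (euclid v *: u - euclid u *: v).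
rewrite !dotvE (dotvC v u) -!sqr_euclid.
set a := euclid u in a0 *; set b := euclid v in b0 *.
have ab0 := mulr_gt0 a0 b0; move=> h.
suff : 0 <= (a * b) * (a * b - dotv u v) by rewrite pmulr_rge0// subr_ge0.
lra.
Qed.

Lemma euclidD {R : realType} {k : nat} (u v : 'rV[R]_k) :
  euclid (u + v) <= euclid u + euclid v.
Proof.
rewrite -(@ler_pXn2r _ 2)// ?nnegrE ?addr_ge0 ?euclid_ge0//.
rewrite sqr_euclid sqrrD !sqr_euclid !dotvE (dotvC v u).
have := cauchy_schwarz u v; lra.
Qed.

(** The norm behind balls and boundedness is the max norm; this comparison carries Euclidean bounds
    over to it. *)
Lemma norm_le_euclid {R : realType} {k : nat} (u : 'rV[R]_k) : `|u| <= euclid u.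
Proof.
rewrite [leLHS]/Num.norm/= mx_normrE; apply/bigmax_leP; split=> [|[i j] _ /=].
  exact: euclid_ge0.
rewrite (ord1 i) -sqrtr_sqr ler_wsqrtr//; exact: sqr_coord_le_dotv.
Qed.

Lemma dotv_mulmx {R : realType} {k l : nat} (w : 'rV[R]_l) (d : 'rV[R]_k)
  (J : 'M[R]_(k, l)) : dotv (w *m J^T) d = dotv w (d *m J).
Proof.
have dE j (u v : 'rV[R]_j) : dotv u v = (u *m v^T) ord0 ord0.
  by rewrite mxE; apply: eq_bigr => i _; rewrite mxE.
by rewrite !dE trmx_mul mulmxA.
Qed.

(** * Limits of matrix expressions and compactness of balls *)

Lemma cvg_matrix {R : realType} {T : Type} {F : set_system T} {FF : Filter F}
  {k l : nat} (f : T -> 'M[R]_(k, l)) (a : 'M[R]_(k, l)) :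
  (forall i j, f x i j @[x --> F] --> a i j) -> f x @[x --> F] --> a.
Proof.
move=> fa A [P aP PA]; apply: (@filterS _ F _ _ _ (fun x => @PA (f x))) => /=.
apply: (filter_forall (f := fun i x => forall j, P i j (f x i j))) => i.
by apply: (filter_forall (f := fun j x => P i j (f x i j))) => j; exact: fa.
Qed.

Lemma cvg_coord {R : realType} {T : Type} {F : set_system T} {FF : Filter F}
  {k l : nat} (f : T -> 'M[R]_(k, l)) (a : 'M[R]_(k, l)) i j :
  f x @[x --> F] --> a -> f x i j @[x --> F] --> a i j.
Proof. by move=> fa A aA; exact: (fa _ (coord_continuous aA)). Qed.

Lemma cvg_bigsum {R : realType} {T : Type} {F : set_system T} {FF : Filter F}
  {k : nat} (f : 'I_k -> T -> R) (a : 'I_k -> R) :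
  (forall i, f i x @[x --> F] --> a i) ->
  \sum_(i < k) f i x @[x --> F] --> \sum_(i < k) a i.
Proof.
move=> fa; elim: k f a fa => [|k IHk] f a fa.
  rewrite big_ord0; under eq_cvg do rewrite big_ord0; exact: cvg_cst.
rewrite big_ord_recl; under eq_cvg do rewrite big_ord_recl.
by apply: cvgD => //; apply: IHk.
Qed.

Lemma cvg_dotv {R : realType} {T : Type} {F : set_system T} {FF : Filter F}
  {k : nat} (f g : T -> 'rV[R]_k) (a b : 'rV[R]_k) :
  f x @[x --> F] --> a -> g x @[x --> F] --> b ->
  dotv (f x) (g x) @[x --> F] --> dotv a b.
Proof.
by move=> fa gb; apply: cvg_bigsum => i; apply: cvgM; apply: cvg_coord.
Qed.

Lemma cvg_mulmx {R : realType} {T : Type} {F : set_system T} {FF : Filter F}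
  {j k l : nat} (f : T -> 'M[R]_(j, k)) (g : T -> 'M[R]_(k, l))
  (a : 'M[R]_(j, k)) (b : 'M[R]_(k, l)) :
  f x @[x --> F] --> a -> g x @[x --> F] --> b ->
  f x *m g x @[x --> F] --> a *m b.
Proof.
move=> fa gb; apply: cvg_matrix => i i'; rewrite mxE.
by under eq_cvg do rewrite mxE; apply: cvg_bigsum => s; apply: cvgM; apply: cvg_coord.
Qed.

Lemma cvg_trmx {R : realType} {T : Type} {F : set_system T} {FF : Filter F}
  {k l : nat} (f : T -> 'M[R]_(k, l)) (a : 'M[R]_(k, l)) :
  f x @[x --> F] --> a -> (f x)^T @[x --> F] --> a^T.
Proof.
move=> fa; apply: cvg_matrix => i j; rewrite mxE.
by under eq_cvg do rewrite mxE; apply: cvg_coord.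
Qed.

Lemma cvg_euclid {R : realType} {T : Type} {F : set_system T} {FF : Filter F}
  {k : nat} (f : T -> 'rV[R]_k) (a : 'rV[R]_k) :
  f x @[x --> F] --> a -> euclid (f x) @[x --> F] --> euclid a.
Proof.
by move=> fa A aA; exact: (cvg_dotv fa fa (sqrt_continuous aA)).
Qed.

Lemma continuous_euclidB {R : realType} {k : nat} (x : 'rV[R]_k) :
  continuous (fun y : 'rV[R]_k => euclid (x - y)).
Proof.
move=> y; have xB : x - z @[z --> y] --> x - y by exact: (cvgB (cvg_cst _) cvg_id).
exact: cvg_euclid xB.
Qed.

Lemma closed_le_fun {R : realType} {T : topologicalType} (f : T -> R) (a : R) :
  continuous f -> closed [set x | f x <= a].
Proof.
move=> cf; apply: (@preimage_closed _ _ f [set y | y <= a]) => [x _|].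
  exact: cf.
exact: closed_le.
Qed.

Lemma compact_euclid_ball {R : realType} {k : nat} (x : 'rV[R]_k) (r : R) :
  compact [set y | euclid (x - y) <= r].
Proof.
apply: bounded_closed_compact; last first.
  by apply: closed_le_fun; exact: continuous_euclidB.
exists (euclid x + r); split; first exact: num_real.
move=> M ltM y /= yr; apply/ltW/(le_lt_trans _ ltM)/(le_trans (norm_le_euclid _)).
rewrite -(subrK x y) addrC (le_trans (euclidD _ _))// lerD2l.
by rewrite -opprB euclidN.
Qed.

(** * Projections and distances *)

(** Cutting [D] with the ball through [y0] makes it compact, so a nearest point exists; if it
    violated the normal inequality at [y], a step towards [y] would come closer to [x]. *)
Lemma exists_projection {R : realType} {k : nat} (D : set 'rV[R]_k)
  (x : 'rV[R]_k) : closed D -> Defs.convex_set D -> D !=set0 ->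
  exists p, D p /\ normal_cone D p (x - p).
Proof.
move=> cD vD [y0 Dy0].
pose A := D `&` [set y | euclid (x - y) <= euclid (x - y0)].
have cA : compact A.
  rewrite /A setIC; apply: (@compact_closedI _ _ D) => //.
  exact: compact_euclid_ball.
have A0 : A !=set0 by exists y0; split => /=.
have cf : {within A, continuous (fun y : 'rV[R]_k => euclid (x - y))}.
  by apply: continuous_subspaceT; exact: continuous_euclidB.
have [p /set_mem[Dp /= py0] pmin] := EVT_min_rV A0 cA cf.
exists p; split=> // y Dy.
have minp z : D z -> dotv (x - p) (x - p) <= dotv (x - z) (x - z).
  move=> Dz; rewrite -!sqr_euclid ler_pXn2r// ?nnegrE ?euclid_ge0//.
  have [zy|/ltW yz] := leP (euclid (x - z)) (euclid (x - y0)).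
    by apply: pmin; apply/mem_set.
  exact: le_trans yz.
rewrite leNgt; apply/negP => a0.
have b0 := dotv_ge0 (y - p).
set a := dotv (x - p) (y - p) in a0; set b := dotv (y - p) (y - p) in b0.
have ab : 0 < a + b by lra.
(* Since [l * b <= a], the squared distance changes by [- 2 * l * a + l ^+ 2 * b <= - l * a < 0]. *)
pose l := a / (a + b).
have l01 : 0 <= l <= 1.
  by rewrite divr_ge0 ?(ltW a0) ?(ltW ab)//= ler_pdivrMr// mul1r lerDl.
have lb : l * b <= a by rewrite /l mulrAC ler_pdivrMr// mulrDr; nra.
have l0 : 0 < l by rewrite divr_gt0.
have := minp _ (vD _ _ _ Dp Dy l01).
have -> : x - ((1 - l) *: p + l *: y) = (x - p) - l *: (y - p).
  by apply/rowP => i; rewrite !mxE; ring.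
rewrite dotv_sqrBZ -/a -/b; nra.
Qed.

Lemma dist_set_le {R : realType} {k : nat} (D : set 'rV[R]_k) (x y : 'rV[R]_k) :
  D y -> dist_set x D <= euclid (x - y).
Proof.
move=> Dy; apply: ge_inf; last by exists y.
by exists 0 => _ [z _ <-]; exact: euclid_ge0.
Qed.

Lemma le_dist_set {R : realType} {k : nat} (D : set 'rV[R]_k) (x : 'rV[R]_k)
  (a : R) : D !=set0 -> (forall y, D y -> a <= euclid (x - y)) ->
  a <= dist_set x D.
Proof.
move=> [y Dy] aD; apply: lb_le_inf; first by exists (euclid (x - y)), y.
by move=> _ [z Dz <-]; exact: aD.
Qed.

(** * Cones, polars and normal cones *)

Lemma cone_add {R : realType} {k : nat} (K : set 'rV[R]_k) (x y : 'rV[R]_k) :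
  is_cone K -> Defs.convex_set K -> K x -> K y -> K (x + y).
Proof.
move=> cK vK Kx Ky.
have -> : x + y = 2 *: ((1 - 2^-1) *: x + 2^-1 *: y).
  by apply/rowP => i; rewrite !mxE; field.
by apply: cK => //; apply: vK => //; lra.
Qed.

(** Throughout, the polar cone of [K] is written [normal_cone K 0]. *)
Lemma polarP {R : realType} {k : nat} (K : set 'rV[R]_k) (w : 'rV[R]_k) :
  normal_cone K 0 w <-> (forall y, K y -> dotv w y <= 0).
Proof. by split=> Kw y /Kw; rewrite subr0. Qed.

(** Testing the normal inequality at [2 *: z] and [0 *: z] forces orthogonality to [z]. *)
Lemma normal_cone_coneP {R : realType} {k : nat} (K : set 'rV[R]_k)
  (z w : 'rV[R]_k) : is_cone K -> Defs.convex_set K -> K z ->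
  normal_cone K z w <-> normal_cone K 0 w /\ dotv w z = 0.
Proof.
move=> cK vK Kz; split=> [Nw|[/polarP Nw wz] y Ky]; last first.
  by rewrite dotvBr wz subr0 Nw.
have wz : dotv w z = 0.
  apply/eqP; rewrite eq_le; apply/andP; split.
    have := Nw (2 *: z) (cK _ _ Kz _); rewrite dotvBr dotvZr => /(_ _); lra.
  have := Nw (0 *: z) (cK _ _ Kz (lexx _)).
  by rewrite dotvBr dotvZr; lra.
by split=> //; apply/polarP => y Ky; have := Nw y Ky; rewrite dotvBr wz subr0.
Qed.

Lemma normal_cone_cone {R : realType} {k : nat} (D : set 'rV[R]_k)
  (x : 'rV[R]_k) : is_cone (normal_cone D x).
Proof. by move=> v l Nv l0 y /Nv; rewrite dotvZl; exact: mulr_ge0_le0. Qed.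

Lemma normal_cone_convex {R : realType} {k : nat} (D : set 'rV[R]_k)
  (x : 'rV[R]_k) : Defs.convex_set (normal_cone D x).
Proof.
move=> u v l Nu Nv /andP[l0 l1] y Dy; rewrite dotvDl !dotvZl.
have := Nu y Dy; have := Nv y Dy; nra.
Qed.

Lemma normal_cone_0 {R : realType} {k : nat} (D : set 'rV[R]_k)
  (x : 'rV[R]_k) : normal_cone D x 0.
Proof. by move=> y _; rewrite dotv0l. Qed.

(** Failure of normality is a strict inequality at one point of [D], stable when vector and base
    point move: normal cones have a closed graph. *)
Lemma normal_cone_near {R : realType} {k : nat} {I : Type} (F : set_system I)
  {FF : Filter F} (g : I -> 'rV[R]_k) (D : set 'rV[R]_k) (x e : 'rV[R]_k) :
  g i @[i --> F] --> x -> ~ normal_cone D x e ->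
  \forall e' \near e & i \near F, ~ normal_cone D (g i) e'.
Proof.
move=> gx /existsNP[y /not_implyP[Dy /negP]]; rewrite -ltNge => exy.
have f1 : (fun p : 'rV[R]_k * I => p.1) p @[p --> filter_prod (nbhs e) F] --> e.
  exact: cvg_fst.
have f2 : (fun p : 'rV[R]_k * I => y - g p.2) p @[p --> filter_prod (nbhs e) F]
    --> y - x.
  have g2 : g p.2 @[p --> filter_prod (nbhs e) F] --> x.
    exact: (cvg_comp _ _ cvg_snd gx).
  exact: (cvgB (cvg_cst _) g2).
suff : filter_prod (nbhs e) F (fun p => ~ normal_cone D (g p.2) p.1) by [].
apply: filterS (cvgr_gt _ (cvg_dotv f1 f2) _ exy) => -[e' i] /= lt0 /(_ y Dy).
by rewrite leNgt lt0.
Qed.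

Lemma normal_cone_closed {R : realType} {k : nat} (D : set 'rV[R]_k)
  (x : 'rV[R]_k) : closed (normal_cone D x).
Proof.
have -> : normal_cone D x = \bigcap_(y in D) [set v | dotv v (y - x) <= 0].
  by apply/seteqP; split=> v Nv y Dy; exact: Nv.
apply: closed_bigI => y _.
apply: (closed_le_fun (f := fun v : 'rV[R]_k => dotv v (y - x))).
move=> v; have vv : w @[w --> v] --> v by exact: cvg_id.
exact: (cvg_dotv vv (cvg_cst (y - x))).
Qed.

(** The residual of the projection of [v] onto [D] separates: it is polar and orthogonal to the
    projection. *)
Lemma cone_separation {R : realType} {k : nat} (D : set 'rV[R]_k)
  (v : 'rV[R]_k) : is_cone D -> Defs.convex_set D -> closed D -> D !=set0 ->
  ~ D v -> exists d, 0 < dotv d v /\ normal_cone D 0 d.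
Proof.
move=> cD vD clD D0 Dv.
have [p [Dp Np]] := exists_projection v clD vD D0.
have [Np0 pp] := (normal_cone_coneP (v - p) cD vD Dp).1 Np.
exists (v - p); split=> //.
have -> : dotv (v - p) v = dotv (v - p) (v - p) by rewrite [RHS]dotvBr pp subr0.
by apply: dotv_gt0; rewrite subr_eq0; apply/eqP => vp; apply: Dv; rewrite vp.
Qed.

Lemma bipolar {R : realType} {k : nat} (K : set 'rV[R]_k) (z : 'rV[R]_k) :
  is_cone K -> Defs.convex_set K -> closed K -> K !=set0 ->
  (forall w, normal_cone K 0 w -> dotv w z <= 0) -> K z.
Proof.
move=> cK vK clK K0 Nz; apply: contrapT => Kz.
have [d [d0 /Nz]] := cone_separation cK vK clK K0 Kz.
by rewrite leNgt d0.
Qed.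

(* Moreau: the residual of the projection onto a cone lies in the polar cone
   and is orthogonal to the projection. *)
Lemma dist_cone_le_polar {R : realType} {k : nat} (K : set 'rV[R]_k)
  (y : 'rV[R]_k) :
  is_cone K -> Defs.convex_set K -> closed K -> K !=set0 ->
  exists w, [/\ normal_cone K 0 w, euclid w <= 1 & dist_set y K <= dotv w y].
Proof.
move=> cK vK clK K0; have [q [Kq Nq]] := exists_projection y clK vK K0.
have [Nq0 qq] := (normal_cone_coneP (y - q) cK vK Kq).1 Nq.
have [yq|yq] := eqVneq (y - q) 0.
  exists 0; split; [exact: normal_cone_0|by rewrite euclid0|].
  by rewrite dotv0l (le_trans (dist_set_le y Kq))// yq euclid0.
have e0 := euclid_gt0 yq.
exists ((euclid (y - q))^-1 *: (y - q)); split.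
- by apply: normal_cone_cone => //; rewrite invr_ge0 ltW.
- by rewrite euclidZ ?invr_ge0 ?(ltW e0)// mulVf// gt_eqF.
- rewrite (le_trans (dist_set_le y Kq))// dotvZl.
  have -> : dotv (y - q) y = euclid (y - q) ^+ 2.
    by rewrite sqr_euclid [RHS]dotvBr qq subr0.
  by rewrite expr2 mulrA mulVf ?mul1r// gt_eqF.
Qed.

(** * Uniformity from compactness of the ball and the sphere *)

(** Compactness glues local statements into one for all [e] at once; [i] will carry a base point, a
    step length or a constant. *)
Lemma unit_ball_near {R : realType} {k : nat} {I : Type} (F : set_system I)
  {FF : Filter F} (P : I -> 'rV[R]_k -> Prop) :
  (forall e, euclid e <= 1 -> \forall e' \near e & i \near F, P i e') ->
  \forall i \near F, forall e, euclid e <= 1 -> P i e.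
Proof.
move=> locP; have := @compact_euclid_ball R k 0 1.
move=> /compact_near_coveringP/(_ I F P FF).
have E e : euclid (0 - e) = euclid e by rewrite sub0r euclidN.
move=> /(_ _)/filterS; apply=> [i Pi e e1|e /=]; last by rewrite E; exact: locP.
by apply: Pi; rewrite /= E.
Qed.

Lemma unit_sphere_near {R : realType} {k : nat} {I : Type} (F : set_system I)
  {FF : Filter F} (P : I -> 'rV[R]_k -> Prop) :
  (forall e, euclid e = 1 -> \forall e' \near e & i \near F, P i e') ->
  \forall i \near F, forall e, euclid e = 1 -> P i e.
Proof.
move=> locP.
have : \forall i \near F, forall e, euclid e <= 1 -> euclid e = 1 -> P i e.
  apply: unit_ball_near => e; rewrite le_eqVlt => /orP[/eqP/locP Pe|e1].
    suff : filter_prod (nbhs e) F (fun p => euclid p.1 = 1 -> P p.2 p.1) by [].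
    by apply: filterS Pe => p Pp _.
  suff : filter_prod (nbhs e) F (fun p => euclid p.1 = 1 -> P p.2 p.1) by [].
  have f1 : (fun p : 'rV[R]_k * I => p.1) p @[p --> filter_prod (nbhs e) F] --> e.
    exact: cvg_fst.
  apply: filterS (cvgr_lt _ (cvg_euclid f1) _ e1) => -[e' i] /= lt1 E.
  by rewrite E ltxx in lt1.
by apply: filterS => i Pi e e1; apply: Pi => //; rewrite e1.
Qed.

(** * Differentiable K-concave maps *)

Lemma cvg_jac_adj {R : realType} {n m : nat} (h : 'rV[R]_n -> 'rV[R]_m)
  {I : Type} (F : set_system I) {FF : Filter F} (f : I -> 'rV[R]_m)
  (g : I -> 'rV[R]_n) (w : 'rV[R]_m) (x : 'rV[R]_n) :
  C1 h -> f i @[i --> F] --> w -> g i @[i --> F] --> x ->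
  jac_adj h (g i) (f i) @[i --> F] --> jac_adj h x w.
Proof.
move=> [_ cJ] fw gx; apply: cvg_mulmx => //; apply: cvg_trmx.
by apply: (cvg_comp _ _ gx); exact: cJ.
Qed.

Lemma C1_continuous {R : realType} {n m : nat} (h : 'rV[R]_n -> 'rV[R]_m) :
  C1 h -> continuous h.
Proof. by move=> [dh _] x; exact: differentiable_continuous. Qed.

Lemma cvg_directional {R : realType} {n m : nat} (h : 'rV[R]_n -> 'rV[R]_m)
  (x d : 'rV[R]_n) : differentiable h x ->
  t^-1 *: (h (x + t *: d) - h x) @[t --> (0 : R)^'+] --> d *m jacobian h x.
Proof.
move=> dh; rewrite -deriveEjacobian//.
have dx : (fun t : R => t^-1 *: (h (x + t *: d) - h x)) =
    (fun t : R => t^-1 *: ((h \o shift x) (t *: d) - h x)).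
  by apply/funext => t /=; rewrite [x + _]addrC.
rewrite dx; apply: cvg_dnbhs_at_right; exact: (diff_derivable (v := d) dh).
Qed.

(** With a difference quotient of step [0 < t <= 1] in place of the derivative, this is K-concavity
    rescaled; [K] is closed, so [t] may tend to 0. *)
Lemma concave_gradient {R : realType} {n m : nat} (K : set 'rV[R]_m)
  (h : 'rV[R]_n -> 'rV[R]_m) (p u : 'rV[R]_n) :
  is_cone K -> closed K -> C1 h -> K_concave K h ->
  K ((u - p) *m jacobian h p + (h p - h u)).
Proof.
move=> cK clK [dh _] vh.
have c : t^-1 *: (h (p + t *: (u - p)) - h p) + (h p - h u) @[t --> (0 : R)^'+]
    --> (u - p) *m jacobian h p + (h p - h u).
  exact: cvgD (cvg_directional (d := u - p) (dh p)) (cvg_cst (h p - h u)).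
apply: (closed_cvg K clK _ _ c); near=> t.
have t0 : 0 < t by near: t; exact: nbhs_right_gt.
have t1 : t <= 1 by near: t; apply: nbhs_right_le.
have t01 : 0 <= t <= 1 by rewrite (ltW t0).
have -> : t^-1 *: (h (p + t *: (u - p)) - h p) + (h p - h u) =
    t^-1 *: (h ((1 - t) *: p + t *: u) - ((1 - t) *: h p + t *: h u)).
  have -> : (1 - t) *: p + t *: u = p + t *: (u - p).
    by apply/rowP => i; rewrite !mxE; ring.
  by apply/rowP => i; rewrite !mxE; field; rewrite gt_eqF.
by apply: cK; [exact: vh|rewrite invr_ge0 ltW].
Unshelve. all: by end_near. Qed.

(** This half of ACQ always holds: adding [h y] to the gradient inequality puts
    [h x + (y - x) *m jacobian h x] in [K], where [w] can be tested. *)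
Lemma jac_adj_normal_cone {R : realType} {n m : nat} (K : set 'rV[R]_m)
  (h : 'rV[R]_n -> 'rV[R]_m) (x : 'rV[R]_n) (w : 'rV[R]_m) :
  is_cone K -> Defs.convex_set K -> closed K -> C1 h -> K_concave K h ->
  K (h x) -> normal_cone K (h x) w ->
  normal_cone (h @^-1` K) x (jac_adj h x w).
Proof.
move=> cK vK clK ch vh Kx Nw y Ky; rewrite dotv_mulmx.
have := Nw _ (cone_add cK vK (concave_gradient x y cK clK ch vh) Ky).
by rewrite addrA subrK addrK.
Qed.

Lemma preimage_concave_convex {R : realType} {n m : nat} (K : set 'rV[R]_m)
  (h : 'rV[R]_n -> 'rV[R]_m) : is_cone K -> Defs.convex_set K ->
  K_concave K h -> Defs.convex_set (h @^-1` K).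
Proof.
move=> cK vK vh x y l Kx Ky l01; rewrite /preimage/=.
by rewrite -[h _](subrK ((1 - l) *: h x + l *: h y)); apply: cone_add; auto.
Qed.

(** The angle at [p] is not acute. With [y = xb], projections of points near [xb] stay near [xb]. *)
Lemma projection_contract {R : realType} {k : nat} (D : set 'rV[R]_k)
  (u p y : 'rV[R]_k) : normal_cone D p (u - p) -> D y ->
  euclid (y - p) <= euclid (y - u).
Proof.
move=> Np Dy; rewrite /euclid ler_wsqrtr//.
have -> : y - u = (y - p) - 1 *: (u - p).
  by apply/rowP => i; rewrite !mxE; ring.
rewrite dotv_sqrBZ (dotvC (y - p)).
have := Np y Dy; have := dotv_ge0 (u - p); lra.
Qed.

(** * From uniform ACQ to the error bound *)

Definition bounded_multipliers {R : realType} {n m : nat}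
  (h : 'rV[R]_n -> 'rV[R]_m) (K : set 'rV[R]_m) (xb : 'rV[R]_n) : Prop :=
  exists2 tau : R, 0 < tau & \forall x \near xb, K (h x) ->
    forall v, normal_cone (h @^-1` K) x v ->
    exists w, [/\ normal_cone K (h x) w, jac_adj h x w = v &
                  euclid w <= tau * euclid v].

Lemma bounded_multipliers_error_bound {R : realType} {n m : nat}
  (K : set 'rV[R]_m) (h : 'rV[R]_n -> 'rV[R]_m) (xb : 'rV[R]_n) :
  is_cone K -> Defs.convex_set K -> closed K -> C1 h -> K_concave K h ->
  K (h xb) -> bounded_multipliers h K xb -> local_error_bound h K xb.
Proof.
move=> cK vK clK ch vh Kxb [tau tau0 /nbhs_ballP[r /= r0 rP]].
have clS : closed (h @^-1` K).
  by apply: preimage_closed => // x _; exact: C1_continuous.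
have vS := preimage_concave_convex cK vK vh.
exists [set u | euclid (xb - u) < r]; split.
  have r1 : euclid (xb - xb) < r by rewrite subrr euclid0.
  exact: (cvgr_lt _ (@continuous_euclidB R n xb xb) _ r1).
exists tau; split=> // u /= ur.
have [p [Sp Np]] := exists_projection u clS vS (ex_intro _ xb Kxb).
have rp : ball xb r p.
  rewrite mx_norm_ball /ball_/=; apply: le_lt_trans (norm_le_euclid _) _.
  exact: le_lt_trans (projection_contract Np Kxb) ur.
have [w [Nw Ew lew]] := rP p rp Sp _ Np.
apply: le_trans (dist_set_le u Sp) _.
have [->|up] := eqVneq (u - p) 0.
  rewrite euclid0 mulr_ge0 ?(ltW tau0)//; apply: le_dist_set; first by exists (h xb).
  by move=> y _; exact: euclid_ge0.
have e0 := euclid_gt0 up.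
rewrite mulrC -ler_pdivrMr//; apply: le_dist_set; first by exists (h xb).
(* For each [q] in [K], the gradient inequality, [<w, h p> = 0] and [<w, q> <= 0] give [|u - p|^2 <=
   <w, h u - q> <= tau |u - p| |h u - q|]. *)
move=> q Kq; rewrite ler_pdivrMr// -(ler_pM2r e0).
have [/polarP Nw0 wp] := (normal_cone_coneP w cK vK Sp).1 Nw.
have -> : euclid (u - p) * euclid (u - p) = dotv w ((u - p) *m jacobian h p).
  by rewrite -dotv_mulmx -/(jac_adj h p w) Ew -expr2 sqr_euclid.
have := Nw0 _ (cone_add cK vK (concave_gradient p u cK clK ch vh) Kq).
have := cauchy_schwarz w (h u - q); rewrite !dotvE wp.
have := ler_wpM2r (euclid_ge0 (h u - q)) lew; lra.
Qed.

(** * From the error bound to ACQ *)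

(** Let [w0 *m M] be the projection of [v] onto the compact convex image of the [r]-ball of [D], and
    [d] the residual. The hypothesis gives [<v, d> <= <w *m M, d> <= <w0 *m M, d>], so [d = 0]. *)
Lemma image_of_support {R : realType} {k l : nat} (D : set 'rV[R]_k)
  (M : 'M[R]_(k, l)) (r : R) (v : 'rV[R]_l) :
  closed D -> Defs.convex_set D -> D 0 -> 0 <= r ->
  (forall w0, D w0 -> euclid w0 <= r -> exists w, [/\ D w, euclid w <= r &
     dotv v (v - w0 *m M) <= dotv (w *m M) (v - w0 *m M)]) ->
  exists w, [/\ D w, euclid w <= r & w *m M = v].
Proof.
move=> clD vD D0 r0 supp.
pose B := [set w | euclid (0 - w) <= r] `&` D.
have BE w : B w <-> D w /\ euclid w <= r.
  by rewrite /B /setI/= sub0r euclidN; split=> -[].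
have cB : compact [set w *m M | w in B].
  apply: continuous_compact; last first.
    by apply: (@compact_closedI _ _ D) => //; exact: compact_euclid_ball.
  apply: continuous_subspaceT => w.
  have ww : z @[z --> w] --> w by exact: cvg_id.
  exact: (cvg_mulmx ww (cvg_cst M)).
have vB : Defs.convex_set [set w *m M | w in B].
  move=> _ _ t [x /BE[Dx xr] <-] [y /BE[Dy yr] <-] t01.
  exists ((1 - t) *: x + t *: y); last by rewrite mulmxDl !scalemxAl.
  apply/BE; split; first exact: vD.
  move/andP: t01 => [t0 t1]; apply: le_trans (euclidD _ _) _.
  rewrite !euclidZ//; [nra|lra].
have [p [[w0 /BE[Dw0 w0r] E] Np]] : exists p, [set w *m M | w in B] p /\
    normal_cone [set w *m M | w in B] p (v - p).
  apply: exists_projection vB _; last first.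
    by exists (0 *m M), 0 => //; apply/BE; rewrite euclid0.
  by apply: compact_closed cB; exact: norm_hausdorff.
rewrite -{p}E in Np.
have [w [Dw wr le]] := supp w0 Dw0 w0r.
have /Np : [set w *m M | w in B] (w *m M) by exists w => //; apply/BE.
rewrite dotvBr dotvC => le0.
exists w0; split=> //; apply/esym/eqP; rewrite -subr_eq0; apply/eqP/dotv_eq0.
apply/le_anti; rewrite dotv_ge0 andbT {1}dotvBl.
by rewrite (dotvC (w0 *m M)); lra.
Qed.

Lemma cvg_line {R : realType} {k : nat} (x d : 'rV[R]_k) :
  (x + t *: d) @[t --> (0 : R)^'+] --> x.
Proof.
have t0 : t @[t --> (0 : R)^'+] --> (0 : R) by exact: cvg_at_right_filter cvg_id.
apply: cvg_matrix => i j; under eq_cvg do rewrite !mxE.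
have := cvgD (cvg_cst (x i j)) (cvgM t0 (cvg_cst (d i j))).
by rewrite mul0r addr0; apply.
Qed.

(** Along [x + t *: d] the distance to [S] is at least [t <v, d> / |v|] and, by the error bound, at
    most [alpha <w, h (x + t *: d)>] for some polar [w] in the unit ball. Letting [t] tend to 0
    gives the support inequality, with radius [alpha |v|]. *)
Lemma error_bound_multiplier {R : realType} {n m : nat} (K : set 'rV[R]_m)
  (h : 'rV[R]_n -> 'rV[R]_m) (x v : 'rV[R]_n) (alpha : R) :
  is_cone K -> Defs.convex_set K -> closed K -> C1 h ->
  0 < alpha ->
  (\forall u \near x, dist_set u (h @^-1` K) <= alpha * dist_set (h u) K) ->
  K (h x) -> normal_cone (h @^-1` K) x v ->
  exists2 w, normal_cone K (h x) w & jac_adj h x w = v.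
Proof.
move=> cK vK clK ch a0 leb Kx Nv.
have K0 : K !=set0 by exists (h x).
have [->|v0] := eqVneq v 0.
  by exists 0; [exact: normal_cone_0|rewrite /jac_adj mul0mx].
have ev0 := euclid_gt0 v0; pose a := alpha * euclid v.
have ap : 0 < a by exact: mulr_gt0.
suff [w [Nw _ wv]] : exists w, [/\ normal_cone K (h x) w, euclid w <= a &
    w *m (jacobian h x)^T = v] by exists w.
apply: image_of_support.
- exact: normal_cone_closed.
- exact: normal_cone_convex.
- exact: normal_cone_0.
- exact: ltW.
move=> w0 _ _; set d := v - _.
suff [w [Nw w1 vd]] : exists w, [/\ normal_cone K (h x) w, euclid w <= 1 &
    dotv v d <= a * dotv w (d *m jacobian h x)].
  exists (a *: w); split.
  - by apply: normal_cone_cone => //; exact: ltW.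
  - by rewrite euclidZ ?(ltW ap)// ler_piMr// ltW.
  - by rewrite dotv_mulmx dotvZl.
apply: contrapT => noW.
have t0 : t @[t --> (0 : R)^'+] --> (0 : R) by exact: cvg_at_right_filter cvg_id.
have xt := @cvg_line R n x d.
have hxt : h (x + t *: d) @[t --> (0 : R)^'+] --> h x.
  by apply: (cvg_comp _ _ xt); exact: C1_continuous.
(* If no multiplier serves the direction [d], the opposite strict inequality holds for small [t],
   uniformly on the polar unit ball. *)
have near0 : \forall t \near (0 : R)^'+, forall w, euclid w <= 1 ->
    normal_cone K 0 w -> a * dotv w (h (x + t *: d)) < t * dotv v d.
  apply: unit_ball_near => w w1.
  suff : filter_prod (nbhs w) (0 : R)^'+ (fun p => normal_cone K 0 p.1 ->
    a * dotv p.1 (h (x + p.2 *: d)) < p.2 * dotv v d) by [].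
  have [Kw|Kw] := pselect (normal_cone K 0 w); last first.
    have nw : filter_prod (nbhs w) (0 : R)^'+ (fun p => ~ normal_cone K 0 p.1).
      have c0 : (fun _ : R => 0 : 'rV[R]_m) t @[t --> (0 : R)^'+] --> (0 : 'rV[R]_m).
        exact: cvg_cst.
      exact: (normal_cone_near c0 Kw).
    by apply: filterS nw => p np /np.
  have f1 : p.1 @[p --> filter_prod (nbhs w) (0 : R)^'+] --> w by exact: cvg_fst.
  have f2 : p.2 @[p --> filter_prod (nbhs w) (0 : R)^'+] --> (0 : R)^'+.
    exact: cvg_snd.
  (* If [<w, h x> = 0], the difference quotient decides; if [<w, h x> < 0], the left side has a
     negative limit and the right side tends to 0. *)
  have := (polarP _ _).1 Kw _ Kx; rewrite le_eqVlt => /orP[/eqP wx|wx].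
    have lt0 : a * dotv w (d *m jacobian h x) < dotv v d.
      rewrite ltNge; apply/negP => vd; apply: noW; exists w; split=> //.
      exact/(normal_cone_coneP w cK vK Kx).
    have dq : p.2^-1 *: (h (x + p.2 *: d) - h x)
        @[p --> filter_prod (nbhs w) (0 : R)^'+] --> d *m jacobian h x.
      exact: (cvg_comp _ _ f2 (cvg_directional (d := d) (ch.1 x))).
    have c : a * dotv p.1 (p.2^-1 *: (h (x + p.2 *: d) - h x))
        @[p --> filter_prod (nbhs w) (0 : R)^'+] --> a * dotv w (d *m jacobian h x).
      exact: (cvgM (cvg_cst a) (cvg_dotv f1 dq)).
    have pos : \forall p \near filter_prod (nbhs w) (0 : R)^'+, 0 < p.2.
      by apply: (f2 [set t | 0 < t]); exact: nbhs_right_gt.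
    apply: filterS2 pos (cvgr_lt _ c _ lt0) => -[w' t] /= tp lt /polarP/(_ _ Kx) w'x.
    move: lt; rewrite dotvZr dotvBr -(ltr_pM2l tp).
    rewrite [X in X < _ -> _](_ : _ =
      a * dotv w' (h (x + t *: d)) - a * dotv w' (h x)).
      by have := mulr_ge0_le0 (ltW ap) w'x; lra.
    by field; rewrite gt_eqF.
  have c : a * dotv p.1 (h (x + p.2 *: d)) - p.2 * dotv v d
      @[p --> filter_prod (nbhs w) (0 : R)^'+] -->
      a * dotv w (h x) - 0 * dotv v d.
    have hp : h (x + p.2 *: d) @[p --> filter_prod (nbhs w) (0 : R)^'+] --> h x.
      exact: (cvg_comp _ _ f2 hxt).
    have p0 : p.2 @[p --> filter_prod (nbhs w) (0 : R)^'+] --> (0 : R).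
      exact: (cvg_comp _ _ f2 t0).
    exact: (cvgB (cvgM (cvg_cst a) (cvg_dotv f1 hp)) (cvgM p0 (cvg_cst _))).
  have lt0 : a * dotv w (h x) - 0 * dotv v d < 0.
    by rewrite mul0r subr0 pmulr_rlt0.
  by apply: filterS (cvgr_lt _ c _ lt0) => -[w' t] /=; rewrite subr_lt0.
near (0 : R)^'+ => t.
have tp : 0 < t by near: t; exact: nbhs_right_gt.
have lebt : dist_set (x + t *: d) (h @^-1` K) <=
    alpha * dist_set (h (x + t *: d)) K.
  by near: t; exact: (xt _ leb).
have [w [Kw w1 wd]] := dist_cone_le_polar (h (x + t *: d)) cK vK clK K0.
(* For [y] in [S], normality gives [<v, x + t *: d - y> >= t <v, d>]. *)
have : t * dotv v d / euclid v <= dist_set (x + t *: d) (h @^-1` K).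
  apply: le_dist_set => [|y Ky]; first by exists x.
  rewrite ler_pdivrMr// mulrC.
  have := cauchy_schwarz v (x + t *: d - y); have := Nv y Ky.
  by rewrite !dotvE; lra.
rewrite ler_pdivrMr// => le1.
have : t * dotv v d <= a * dotv w (h (x + t *: d)).
  rewrite (le_trans le1)// /a mulrAC ler_pM2r// (le_trans lebt)//.
  by rewrite ler_pM2l.
apply/negP; rewrite -ltNge; move: w w1 Kw {wd}; near: t; exact: near0.
Unshelve. all: by end_near. Qed.

(** * Faces of a smooth cone and of its polar *)

(** Moving from [z] along [w] leaves [K] at once: [<w, z + t *: w> = t |w|^2 > 0]. *)
Lemma polar_orthogonal_boundary {R : realType} {k : nat} (K : set 'rV[R]_k)
  (z w : 'rV[R]_k) : normal_cone K 0 w -> w != 0 -> K z -> dotv w z = 0 ->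
  (closure K `\` K°) z.
Proof.
move=> /polarP Kw w0 Kz wz; split; first exact: subset_closure.
move=> /(@cvg_line R k z w) zK; near (0 : R)^'+ => t.
have t0 : 0 < t by near: t; exact: nbhs_right_gt.
have /Kw : K (z + t *: w) by near: t; exact: zK.
by rewrite dotvDr wz add0r dotvZr leNgt mulr_gt0// dotv_gt0.
Unshelve. all: by end_near. Qed.

(** The boundary point [e] lies on an extreme ray, where normals span only a line. *)
Lemma smooth_normal_collinear {R : realType} {k : nat} (K : set 'rV[R]_k)
  (e u w : 'rV[R]_k) : smooth_cone K -> K e -> e != 0 -> u != 0 ->
  normal_cone K 0 u -> dotv u e = 0 -> normal_cone K 0 w -> dotv w e = 0 ->
  exists c : R, w = c *: u.
Proof.
move=> [[cK _ _ vK _] bK dK] Ke e0 u0 Ku ue Kw we.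
have [x [ex xe]] := bK _ (polar_orthogonal_boundary Ku u0 Ke ue).
have [v [v0 _ vP]] := dK x e ex xe e0.
have [a ua] : exists a, u = a *: v by apply/vP/(normal_cone_coneP u cK vK Ke).
have [b wb] : exists b, w = b *: v by apply/vP/(normal_cone_coneP w cK vK Ke).
have a0 : a != 0 by apply: contra_neq u0 => a0; rewrite ua a0 scale0r.
by exists (b / a); rewrite ua scalerA divfK.
Qed.

(** The midpoint of [x] and [y] is a boundary point, so it lies on an extreme ray, and the face
    property pulls both ends into that ray. *)
Lemma smooth_face_collinear {R : realType} {k : nat} (K : set 'rV[R]_k)
  (w x y : 'rV[R]_k) : smooth_cone K -> normal_cone K 0 w -> w != 0 ->
  K x -> K y -> y != 0 -> dotv w x = 0 -> dotv w y = 0 ->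
  exists c : R, x = c *: y.
Proof.
move=> [[cK _ _ vK _] bK _] Kw w0 Kx Ky y0 wx wy.
have h01 : 0 < (2^-1 : R) < 1 by lra.
have Kz : K (2^-1 *: x + (1 - 2^-1) *: y).
  by apply: cone_add => //; apply: cK => //; lra.
have wz : dotv w (2^-1 *: x + (1 - 2^-1) *: y) = 0 by rewrite !dotvE wx wy; ring.
have [z [[_ [_ _ fz]] zP]] := bK _ (polar_orthogonal_boundary Kw w0 Kz wz).
have [[a _ xa] [b _ yb]] := fz _ _ _ Kx Ky h01 zP.
have b0 : b != 0 by apply: contra_neq y0 => b0; rewrite -yb b0 scale0r.
by exists (a / b); rewrite -xa -yb scalerA divfK.
Qed.

(* A functional [d] that is nonpositive on the image corresponds to the point
   [d *m M] of [K], which lies in the face of [K] orthogonal to [w0].  Smoothness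
   makes this face a ray, so modulo the annihilator of the image and positive
   factors there is at most one nonzero such [d]. *)
Lemma closed_image_polar {R : realType} {n m : nat} (K : set 'rV[R]_m)
  (M : 'M[R]_(n, m)) (N : set 'rV[R]_n) (w0 : 'rV[R]_m) :
  smooth_cone K -> is_cone N -> Defs.convex_set N -> closed N ->
  [set w *m M^T | w in normal_cone K 0] = N ->
  normal_cone K 0 w0 -> w0 != 0 -> w0 *m M^T = 0 ->
  (forall u, N (u *m M^T)) \/
  (forall v v', N v -> N v' -> v != 0 -> v' != 0 ->
     exists2 c : R, 0 < c & v = c *: v').
Proof.
move=> sK cN vN clN NE Kw0 w00 w0M.
have [[cK _ clK vK [x0 /interior_subset Kx0]] _ _] := sK.
have K0 : K !=set0 by exists x0.
have N0 : N 0 by rewrite -NE; exists 0; [exact: normal_cone_0|rewrite mul0mx].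
have w0dM d : dotv w0 (d *m M) = 0 by rewrite -dotv_mulmx w0M dotv0l.
have sep u : ~ N (u *m M^T) -> exists d, 0 < dotv u (d *m M) /\ K (d *m M).
  move=> /(cone_separation cN vN clN (ex_intro _ 0 N0))[d [du /polarP dN]].
  exists d; split; first by rewrite -dotv_mulmx dotvC.
  apply: bipolar => // w Kw; rewrite -dotv_mulmx dotvC; apply: dN.
  by rewrite -NE; exists w.
(* If no nonzero [d *m M] lies in [K], nothing in the range can be separated from [N]. *)
have [[d0 [Kd0 d00]]|nod] := pselect (exists d, K (d *m M) /\ d *m M != 0); last first.
  left=> u; apply: contrapT => /sep[d [ud Kd]].
  have [d0|d0] := eqVneq (d *m M) 0; first by rewrite d0 dotv0r ltxx in ud.
  by apply: nod; exists d.
right.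
have only0 w : normal_cone K 0 w -> dotv w (d0 *m M) = 0 -> w *m M^T = 0.
  move=> Kw we.
  have [c ->] := smooth_normal_collinear sK Kd0 d00 w00 Kw0 (w0dM d0) Kw we.
  by rewrite -scalemxAl w0M scaler0.
have neg w : normal_cone K 0 w -> w *m M^T != 0 -> dotv w (d0 *m M) < 0.
  move=> Kw wM; rewrite lt_def ((polarP _ _).1 Kw)// andbT eq_sym.
  by apply: contra_neq wM => /only0; exact.
move=> v v'; rewrite -{1 2}NE => -[w Kw <-{v}] [w' Kw' <-{v'}].
move=> /(neg w Kw) lt /(neg w' Kw') lt'.
(* This [c] makes [w - c *: w'] orthogonal to [d0 *m M], hence to every [d *m M] in [K]. Its image
   is therefore in [N], and comes from a polar vector orthogonal to [d0 *m M], which the map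
   kills. *)
pose c := dotv w (d0 *m M) / dotv w' (d0 *m M).
have c0 : 0 < c by rewrite /c -mulrNN -invrN divr_gt0// oppr_gt0.
exists c => //.
have E : dotv (w - c *: w') (d0 *m M) = 0.
  by rewrite !dotvE /c divfK ?subrr// lt_eqF.
have : N ((w - c *: w') *m M^T).
  apply: contrapT => /sep[d [ud Kd]].
  have [b db] := smooth_face_collinear sK Kw0 w00 Kd Kd0 d00 (w0dM d) (w0dM d0).
  by rewrite db dotvZr E mulr0 ltxx in ud.
rewrite -NE => -[u Ku uE].
have u0 : dotv u (d0 *m M) = 0 by rewrite -dotv_mulmx uE dotv_mulmx.
move: uE; rewrite (only0 u Ku u0) mulmxBl -scalemxAl => /esym/eqP.
by rewrite subr_eq0 => /eqP.
Qed.

(** * From ACQ to uniform ACQ *)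

Lemma trivial_normal_multipliers {R : realType} {n m : nat} (K : set 'rV[R]_m)
  (h : 'rV[R]_n -> 'rV[R]_m) (xb : 'rV[R]_n) :
  (forall v, normal_cone (h @^-1` K) xb v -> v = 0) ->
  bounded_multipliers h K xb.
Proof.
move=> N0; exists 1 => //.
have : \forall x \near xb, forall e, euclid e = 1 ->
    ~ normal_cone (h @^-1` K) x e.
  apply: (unit_sphere_near (F := nbhs xb)) => e e1.
  apply: (@normal_cone_near _ _ _ _ _ id) => [|/N0 e0]; first exact: cvg_id.
  by move: e1; rewrite e0 euclid0 => /esym/eqP; rewrite oner_eq0.
apply: filterS => x Nx Kx v Nv; exists 0.
have [->|v0] := eqVneq v 0.
  by rewrite /jac_adj mul0mx !euclid0 mulr0; split => //; exact: normal_cone_0.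
have ev := euclid_gt0 v0; exfalso; apply: (Nx ((euclid v)^-1 *: v)).
  by rewrite euclidZ ?invr_ge0 ?(ltW ev)// mulVf// gt_eqF.
by apply: normal_cone_cone => //; rewrite invr_ge0 ltW.
Qed.

(** The constant sought is a variable tending to 0 from the right, so one compactness argument
    yields it together with the neighbourhood. *)
Lemma near_prod_right {R : realType} {k : nat} (x : 'rV[R]_k)
  (Q : 'rV[R]_k -> R -> Prop) :
  (\forall p \near filter_prod (nbhs x) (0 : R)^'+, Q p.1 p.2) ->
  exists2 c : R, 0 < c & \forall y \near x, Q y c.
Proof.
case=> -[A B] /= [xA B0] AB; near (0 : R)^'+ => c.
exists c; first by near: c; exact: nbhs_right_gt.
have Bc : B c by near: c.
by apply: filterS xA => y Ay; exact: (AB (y, c)).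
Unshelve. all: by end_near. Qed.

Lemma near_prod_half {R : realType} {k l : nat} (e : 'rV[R]_l) (x : 'rV[R]_k)
  (f : 'rV[R]_l -> 'rV[R]_k -> R) :
  f q.1 q.2.1 @[q --> filter_prod (nbhs e) (filter_prod (nbhs x) (0 : R)^'+)]
    --> f e x -> 0 < f e x ->
  \forall q \near filter_prod (nbhs e) (filter_prod (nbhs x) (0 : R)^'+),
    q.2.2 <= f q.1 q.2.1.
Proof.
move=> fc f0; have f2 : f e x / 2 < f e x by lra.
have c0 : q.2.2 @[q --> filter_prod (nbhs e) (filter_prod (nbhs x) (0 : R)^'+)]
    --> (0 : R)^'+ by exact: (cvg_comp _ _ cvg_snd cvg_snd).
have small : \forall c \near (0 : R)^'+, c < f e x / 2.
  by apply: nbhs_right_lt; lra.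
pose G := filter_prod (nbhs e) (filter_prod (nbhs x) (0 : R)^'+).
have sm : \forall q \near G, q.2.2 < f e x / 2 by exact: (c0 _ small).
have gt : \forall q \near G, f e x / 2 < f q.1 q.2.1.
  exact: (cvgr_gt _ fc _ f2).
suff : G (fun q => q.2.2 <= f q.1 q.2.1) by [].
by apply: filterS2 sm gt => q; lra.
Qed.

(** Over unit normals [e] at points near [xb], [|jac_adj h x e|] has a positive lower bound [c]; by
    homogeneity every multiplier supplied by ACQ has [|w| <= |v| / c]. *)
Lemma injective_multipliers {R : realType} {n m : nat} (K : set 'rV[R]_m)
  (h : 'rV[R]_n -> 'rV[R]_m) (xb : 'rV[R]_n) (U : set 'rV[R]_n) :
  C1 h -> nbhs xb U -> ACQ_on h K U ->
  (forall w, normal_cone K (h xb) w -> jac_adj h xb w = 0 -> w = 0) ->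
  bounded_multipliers h K xb.
Proof.
move=> ch xbU acq inj.
have [c c0 cP] : exists2 c : R, 0 < c & \forall x \near xb, forall e,
    euclid e = 1 -> normal_cone K (h x) e -> c <= euclid (jac_adj h x e).
  apply: near_prod_right.
  apply: (unit_sphere_near (F := filter_prod (nbhs xb) (0 : R)^'+)) => e e1.
  pose G := filter_prod (nbhs e) (filter_prod (nbhs xb) (0 : R)^'+).
  suff : G (fun q => normal_cone K (h q.2.1) q.1 ->
      q.2.2 <= euclid (jac_adj h q.2.1 q.1)) by [].
  have g1 : p.1 @[p --> filter_prod (nbhs xb) (0 : R)^'+] --> xb.
    exact: cvg_fst.
  have [Ne|Ne] := pselect (normal_cone K (h xb) e); last first.
    have hg : h p.1 @[p --> filter_prod (nbhs xb) (0 : R)^'+] --> h xb.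
      by apply: (cvg_comp _ _ g1); exact: C1_continuous.
    have nN : G (fun q => ~ normal_cone K (h q.2.1) q.1).
      exact: (normal_cone_near hg Ne).
    by apply: filterS nN => q nq /nq.
  have f0 : 0 < euclid (jac_adj h xb e).
    apply/euclid_gt0/eqP => /(inj e Ne) e0.
    by move: e1; rewrite e0 euclid0 => /esym/eqP; rewrite oner_eq0.
  have q1 : q.1 @[q --> G] --> e by exact: cvg_fst.
  have q2 : q.2.1 @[q --> G] --> xb by exact: (cvg_comp _ _ cvg_snd g1).
  have c : euclid (jac_adj h q.2.1 q.1) @[q --> G] --> euclid (jac_adj h xb e).
    exact: (cvg_euclid (cvg_jac_adj ch q1 q2)).
  have nh := near_prod_half (f := fun e x => euclid (jac_adj h x e)) c f0.
  by apply: filterS nh => q.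
exists c^-1; first by rewrite invr_gt0.
apply: filterS2 xbU cP => x Ux cx Kx v; rewrite -(acq x)// => -[w Nw <-{v}].
exists w; split=> //; have [->|w0] := eqVneq w 0.
  by rewrite euclid0 mulr_ge0 ?euclid_ge0// invr_ge0 ltW.
have ew := euclid_gt0 w0.
have e1 : euclid ((euclid w)^-1 *: w) = 1.
  by rewrite euclidZ ?invr_ge0 ?(ltW ew)// mulVf// gt_eqF.
have Ne : normal_cone K (h x) ((euclid w)^-1 *: w).
  by apply: normal_cone_cone => //; rewrite invr_ge0 ltW.
have := cx _ e1 Ne; rewrite /jac_adj -scalemxAl euclidZ ?invr_ge0 ?(ltW ew)//.
by rewrite !ler_pdivlMl// mulrC.
Qed.

(** Both signs are normal exactly when [<v, _>] is constant on [D], a condition independent of the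
    base point. *)
Lemma normal_cone_oppP {R : realType} {k : nat} (D : set 'rV[R]_k)
  (x y v : 'rV[R]_k) : D x -> D y -> normal_cone D x v ->
  normal_cone D x (- v) -> normal_cone D y v /\ normal_cone D y (- v).
Proof.
move=> Dx Dy Nv NvN.
have E z : D z -> dotv v (z - x) = 0.
  move=> Dz; have := Nv z Dz; have := NvN z Dz; rewrite dotvNl; lra.
by split=> z Dz; have := E z Dz; have := E y Dy; rewrite !dotvE; lra.
Qed.

(** The gradient inequality at [xb] makes [<k, h _>] nonnegative everywhere, and polarity makes it
    nonpositive on [S]. Points of [S] are thus minimisers, where its gradient vanishes. *)
Lemma kernel_multiplier_spread {R : realType} {n m : nat} (K : set 'rV[R]_m)
  (h : 'rV[R]_n -> 'rV[R]_m) (xb x : 'rV[R]_n) (k : 'rV[R]_m) :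
  is_cone K -> closed K -> C1 h -> K_concave K h ->
  h xb = 0 -> normal_cone K 0 k -> jac_adj h xb k = 0 -> K (h x) ->
  dotv k (h x) = 0 /\ jac_adj h x k = 0.
Proof.
move=> cK clK ch vh hxb /polarP Kk k0 Kx.
have hge u : 0 <= dotv k (h u).
  have := Kk _ (concave_gradient xb u cK clK ch vh).
  by rewrite hxb !dotvE -dotv_mulmx -/(jac_adj h xb k) k0 dotv0l; lra.
have kx : dotv k (h x) = 0 by apply/le_anti; rewrite Kk// hge.
split; first exact: kx.
apply: dotv_eq0; apply: le_anti; rewrite dotv_ge0 andbT leNgt.
apply/negP => v0; pose d := - jac_adj h x k.
have lt0 : dotv k (d *m jacobian h x) < 0.
  by rewrite -dotv_mulmx -/(jac_adj h x k) /d dotvC dotvNl oppr_lt0.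
have c : dotv k (t^-1 *: (h (x + t *: d) - h x)) @[t --> (0 : R)^'+]
    --> dotv k (d *m jacobian h x).
  exact: (cvg_dotv (cvg_cst k) (cvg_directional (d := d) (ch.1 x))).
near (0 : R)^'+ => t.
have t0 : 0 < t by near: t; exact: nbhs_right_gt.
have : dotv k (t^-1 *: (h (x + t *: d) - h x)) < 0.
  by near: t; exact: (cvgr_lt _ c _ lt0).
by apply/negP; rewrite -leNgt dotvZr dotvBr kx subr0 mulr_ge0// invr_ge0 ltW.
Unshelve. all: by end_near. Qed.

(** If [h x] were nonzero, all normals there would be multiples of [k], hence killed. So [h x = 0],
    and [N_S(x)] is the image of the whole polar cone. *)
Lemma kernel_multiplier_dichotomy {R : realType} {n m : nat} (K : set 'rV[R]_m)
  (h : 'rV[R]_n -> 'rV[R]_m) (U : set 'rV[R]_n) (x : 'rV[R]_n) (k : 'rV[R]_m) :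
  smooth_cone K -> ACQ_on h K U -> U x -> K (h x) ->
  normal_cone K 0 k -> k != 0 -> dotv k (h x) = 0 -> jac_adj h x k = 0 ->
  (exists2 v, normal_cone (h @^-1` K) x v & v != 0) ->
  h x = 0 /\
  ((forall w, normal_cone (h @^-1` K) x (jac_adj h x w)) \/
   (forall v v', normal_cone (h @^-1` K) x v -> normal_cone (h @^-1` K) x v' ->
      v != 0 -> v' != 0 -> exists2 c : R, 0 < c & v = c *: v')).
Proof.
move=> sK acq Ux Kx Kk k0 khx kx [v Nv v0].
have [[cK _ _ vK _] _ _] := sK.
have hx0 : h x = 0.
  apply/eqP; apply: contraT => hx0; move: Nv; rewrite -(acq x)// => -[w].
  move=> /(normal_cone_coneP w cK vK Kx)[Kw whx] wv.
  have [c wk] := smooth_normal_collinear sK Kx hx0 k0 Kk khx Kw whx.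
  by move: v0; rewrite -wv wk /jac_adj -scalemxAl -/(jac_adj h x k) kx scaler0 eqxx.
split; first exact: hx0.
apply: (closed_image_polar (M := jacobian h x) (w0 := k) sK) => //.
- exact: normal_cone_cone.
- exact: normal_cone_convex.
- exact: normal_cone_closed.
- by rewrite -(acq x)// hx0.
Qed.

(** One fixed [wb] serves all nearby points: its image there is a nonzero normal, so a ray of
    normals consists of its multiples. *)
Lemma ray_multipliers {R : realType} {n m : nat} (K : set 'rV[R]_m)
  (h : 'rV[R]_n -> 'rV[R]_m) (xb : 'rV[R]_n) (U : set 'rV[R]_n)
  (wb : 'rV[R]_m) : C1 h -> K (h xb) -> nbhs xb U -> ACQ_on h K U ->
  normal_cone K 0 wb -> jac_adj h xb wb != 0 ->
  (forall v, normal_cone (h @^-1` K) xb v ->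
     normal_cone (h @^-1` K) xb (- v) -> v = 0) ->
  (forall x, U x -> K (h x) ->
     (exists2 v, normal_cone (h @^-1` K) x v & v != 0) ->
     h x = 0 /\
     ((forall w, normal_cone (h @^-1` K) x (jac_adj h x w)) \/
      (forall v v', normal_cone (h @^-1` K) x v ->
        normal_cone (h @^-1` K) x v' -> v != 0 -> v' != 0 ->
        exists2 c : R, 0 < c & v = c *: v'))) ->
  bounded_multipliers h K xb.
Proof.
move=> ch Kxb xbU acq Kwb vb0 pointed dich.
set b := euclid (jac_adj h xb wb).
have b0 : 0 < b by exact: euclid_gt0.
have wb0 := euclid_ge0 wb.
(* Near [xb] the image of [wb] has norm above [b / 2]; the [+ 1] makes positivity immediate. *)
exists (2 * euclid wb / b + 1).
  by rewrite ltr_wpDl// divr_ge0 ?(ltW b0)// mulr_ge0.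
have nA : \forall x \near xb, b / 2 < euclid (jac_adj h x wb).
  have c : jac_adj h x wb @[x --> xb] --> jac_adj h xb wb.
    have xx : x @[x --> xb] --> xb by exact: cvg_id.
    exact: (cvg_jac_adj ch (cvg_cst wb) xx).
  have b2 : b / 2 < b by lra.
  exact: (cvgr_gt _ (cvg_euclid c) _ b2).
apply: filterS2 xbU nA => x Ux Ax Kx v Nv.
have [->|v0] := eqVneq v 0.
  exists 0; rewrite /jac_adj mul0mx !euclid0 mulr0.
  by split => //; exact: normal_cone_0.
have [hx0 [sub|ray]] := dich x Ux Kx (ex_intro2 _ _ v Nv v0).
  (* A subspace of normals at [x] would make [v] and [- v] normal at [xb] too, against
     pointedness. *)
  have NvN : normal_cone (h @^-1` K) x (- v).
    move: (Nv); rewrite -(acq x)// => -[w _ wv].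
    by rewrite -wv -mulNmx acq//; exact: sub.
  have [N1 N2] := normal_cone_oppP (D := h @^-1` K) Kx Kxb Nv NvN.
  by rewrite (pointed v N1 N2) eqxx in v0.
have Nwb : normal_cone (h @^-1` K) x (jac_adj h x wb).
  by rewrite -(acq x)//; exists wb => //; rewrite hx0.
have Awb0 : jac_adj h x wb != 0.
  by apply/eqP => E; move: Ax; rewrite E euclid0; lra.
have [c c0 vE] := ray v _ Nv Nwb v0 Awb0.
exists (c *: wb); split.
- by apply: normal_cone_cone; [rewrite hx0|exact: ltW].
- by rewrite vE /jac_adj -scalemxAl.
rewrite vE !euclidZ ?(ltW c0)// mulrCA ler_pM2l//.
move: (euclid wb) wb0 (euclid (jac_adj h x wb)) Ax => s s0 a ba.
clearbody b.
have q0 : 0 <= 2 * s / b by rewrite divr_ge0 ?(ltW b0)// mulr_ge0.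
have E : s = 2 * s / b * (b / 2) by field; rewrite gt_eqF.
rewrite [leLHS]E mulrDl mul1r; have := ler_wpM2l q0 (ltW ba); lra.
Qed.

(** Each unit [e] in [N] pairs positively with the image of some polar unit vector. Compactness
    makes this uniform near [xb], and the support criterion turns it into multipliers of norm at
    most [|v| / c]. *)
Lemma subspace_multipliers {R : realType} {n m : nat} (K : set 'rV[R]_m)
  (h : 'rV[R]_n -> 'rV[R]_m) (xb : 'rV[R]_n) (U : set 'rV[R]_n) :
  C1 h -> h xb = 0 -> K (h xb) -> nbhs xb U -> ACQ_on h K U ->
  (forall x, U x -> K (h x) -> h x = 0 /\
     forall w, normal_cone (h @^-1` K) xb (jac_adj h x w)) ->
  bounded_multipliers h K xb.
Proof.
move=> ch hxb Kxb xbU acq sub; set N := normal_cone (h @^-1` K) xb.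
have NE : jac_adj h xb @` normal_cone K 0 = N.
  by rewrite -hxb; apply: acq; split=> //; exact: nbhs_singleton.
have [c c0 cP] : exists2 c : R, 0 < c & \forall x \near xb, forall e,
    euclid e = 1 -> N e -> exists w, [/\ normal_cone K 0 w, euclid w <= 1 &
      c <= dotv (jac_adj h x w) e].
  apply: near_prod_right.
  apply: (unit_sphere_near (F := filter_prod (nbhs xb) (0 : R)^'+)) => e e1.
  pose G := filter_prod (nbhs e) (filter_prod (nbhs xb) (0 : R)^'+).
  suff : G (fun q => N q.1 -> exists w, [/\ normal_cone K 0 w, euclid w <= 1 &
      q.2.2 <= dotv (jac_adj h q.2.1 w) q.1]) by [].
  have q1 : q.1 @[q --> G] --> e by exact: cvg_fst.
  have [Ne|Ne] := pselect (N e); last first.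
    have cx : (fun=> xb) p @[p --> filter_prod (nbhs xb) (0 : R)^'+] --> xb.
      exact: cvg_cst.
    have nN : G (fun q => ~ N q.1) by exact: (normal_cone_near cx Ne).
    by apply: filterS nN => q nq /nq.
  have g1 : p.1 @[p --> filter_prod (nbhs xb) (0 : R)^'+] --> xb.
    exact: cvg_fst.
  have q2 : q.2.1 @[q --> G] --> xb by exact: (cvg_comp _ _ cvg_snd g1).
  move: (Ne); rewrite -NE => -[w1 Kw1 w1e].
  have w10 : 0 < euclid w1.
    apply/euclid_gt0/eqP => w0; move: e1; rewrite -w1e w0 /jac_adj mul0mx euclid0.
    by move=> /esym/eqP; rewrite oner_eq0.
  (* As [w1] maps to the unit vector [e], the pairing of the image of [w] with [e] is [1 / |w1|]. *)
  pose w := (euclid w1)^-1 *: w1.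
  have Kw : normal_cone K 0 w.
    by apply: normal_cone_cone => //; rewrite invr_ge0 ltW.
  have ew : euclid w = 1.
    by rewrite euclidZ ?invr_ge0 ?(ltW w10)// mulVf// gt_eqF.
  have f0 : 0 < dotv (jac_adj h xb w) e.
    rewrite /jac_adj -scalemxAl -/(jac_adj h xb w1) w1e dotvZl -sqr_euclid e1.
    by rewrite expr1n mulr1 invr_gt0.
  have cv : dotv (jac_adj h q.2.1 w) q.1 @[q --> G] --> dotv (jac_adj h xb w) e.
    exact: (cvg_dotv (cvg_jac_adj ch (cvg_cst w) q2) q1).
  have nh := near_prod_half (f := fun e x => dotv (jac_adj h x w) e) cv f0.
  by apply: filterS nh => q qle _; exists w; rewrite ew.
exists c^-1; first by rewrite invr_gt0.
apply: filterS2 xbU cP => x Ux cx Kx v Nv.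
have [hx0 subx] := sub x Ux Kx.
move: Nv; rewrite -(acq x)// hx0 => -[w1 _ w1v].
have [w [Kw wr wv]] : exists w, [/\ normal_cone K 0 w,
    euclid w <= c^-1 * euclid v & w *m (jacobian h x)^T = v].
  have r0 : 0 <= c^-1 * euclid v.
    by rewrite mulr_ge0 ?euclid_ge0// invr_ge0 ltW.
  apply: (image_of_support _ _ _ r0).
  - exact: normal_cone_closed.
  - exact: normal_cone_convex.
  - exact: normal_cone_0.
  move=> w0 _ _; set d := v - _.
  have [d0|d0] := eqVneq d 0.
    exists 0; split; [exact: normal_cone_0|by rewrite euclid0|].
    by rewrite d0 !dotv0r.
  have ed := euclid_gt0 d0.
  (* The residual is in the range at [x], which lies in [N], so the uniform bound applies to its
     direction. *)
  have Nd : N d by rewrite /d -w1v /jac_adj -mulmxBl; exact: subx.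
  pose e := (euclid d)^-1 *: d.
  have e1 : euclid e = 1.
    by rewrite euclidZ ?invr_ge0 ?(ltW ed)// mulVf// gt_eqF.
  have Ne : N e by apply: normal_cone_cone => //; rewrite invr_ge0 ltW.
  have [w [Kw w1' le]] := cx e e1 Ne.
  exists ((c^-1 * euclid v) *: w); split.
  - exact: normal_cone_cone.
  - by rewrite euclidZ// ler_piMr.
  - rewrite -scalemxAl dotvZl.
    have dE u : dotv u d = euclid d * dotv u e.
      by rewrite dotvZr mulrA divff ?mul1r// gt_eqF.
    rewrite (dE v) (dE (w *m _)) [leRHS]mulrCA ler_pM2l//.
    have := cauchy_schwarz v e; rewrite e1 mulr1 => /le_trans; apply.
    have := ler_wpM2l r0 le; rewrite mulrAC mulVf ?gt_eqF// mul1r; exact.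
by exists w.
Qed.

Lemma eq0_of_neg_multiple {R : realType} {k : nat} (c : R) (v : 'rV[R]_k) :
  0 < c -> v = c *: - v -> v = 0.
Proof.
move=> c0 E; apply/rowP => i; move/rowP/(_ i): E; rewrite !mxE => E.
have c1 : 0 < 1 + c by lra.
apply: (mulfI (lt0r_neq0 c1)); rewrite mulr0 mulrDl mul1r {1}E; ring.
Qed.

Lemma ACQ_bounded_multipliers {R : realType} {n m : nat} (K : set 'rV[R]_m)
  (h : 'rV[R]_n -> 'rV[R]_m) (xb : 'rV[R]_n) (U : set 'rV[R]_n) :
  smooth_cone K -> C1 h -> K_concave K h -> K (h xb) ->
  nbhs xb U -> ACQ_on h K U -> bounded_multipliers h K xb.
Proof.
move=> sK ch vh Kxb xbU acq; have [[cK _ clK vK _] _ _] := sK.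
have Uxb : U xb by exact: nbhs_singleton.
have [[k [Nk kA k0]]|inj] := pselect (exists k, [/\ normal_cone K (h xb) k,
    jac_adj h xb k = 0 & k != 0]); last first.
  apply: (injective_multipliers ch xbU acq) => w Nw w0.
  by apply/eqP; apply: contraT => wn0; exfalso; apply: inj; exists w.
have [Kk kh] := (normal_cone_coneP k cK vK Kxb).1 Nk.
have [[vb Nvb vb0]|triv] :=
    pselect (exists2 v, normal_cone (h @^-1` K) xb v & v != 0); last first.
  apply: trivial_normal_multipliers => v Nv.
  by apply/eqP; apply: contraT => v0; exfalso; apply: triv; exists v.
have [hxb dichb] := kernel_multiplier_dichotomy sK acq Uxb Kxb Kk k0 kh kA
  (ex_intro2 _ _ vb Nvb vb0).
(* The vector [k] stays orthogonal and killed on all of [S], so the dichotomy holds throughout [S]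
   within [U]. *)
have dich x : U x -> K (h x) ->
    (exists2 v, normal_cone (h @^-1` K) x v & v != 0) -> _ :=
  fun Ux Kx => let: conj kx kAx :=
    kernel_multiplier_spread cK clK ch vh hxb Kk kA Kx in
  kernel_multiplier_dichotomy sK acq Ux Kx Kk k0 kx kAx.
case: dichb => [sub|rayb].
  apply: (subspace_multipliers ch hxb Kxb xbU acq) => x Ux Kx.
  have opp y w : (forall w, normal_cone (h @^-1` K) y (jac_adj h y w)) ->
      normal_cone (h @^-1` K) y (- jac_adj h y w).
    by move=> suby; rewrite /jac_adj -mulNmx; exact: suby.
  have [wb _ wbE] : (jac_adj h xb @` normal_cone K (h xb)) vb by rewrite acq.
  have NvbN : normal_cone (h @^-1` K) xb (- vb) by rewrite -wbE; exact: opp.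
  (* Both signs of [vb] are normal at [x] as well, which excludes the ray there; the subspace of
     normals at [x] then carries back to [xb]. *)
  have [N1 N2] := normal_cone_oppP (D := h @^-1` K) Kxb Kx Nvb NvbN.
  have [hx0 [subx|rayx]] := dich x Ux Kx (ex_intro2 _ _ vb N1 vb0).
    split=> [|w]; first exact: hx0.
    have [Nw _] := normal_cone_oppP (D := h @^-1` K) Kx Kxb (subx w)
      (opp x w subx).
    exact: Nw.
  have [|c c0 E] := rayx _ _ N1 N2 vb0; first by rewrite oppr_eq0.
  by rewrite (eq0_of_neg_multiple c0 E) eqxx in vb0.
move: (Nvb); rewrite -(acq xb)// hxb => -[wb Kwb wbE].
apply: (ray_multipliers ch Kxb xbU acq Kwb _ _ dich); first by rewrite wbE.
move=> v Nv NvN; apply/eqP; apply: contraT => v0.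
have [|c c0 E] := rayb _ _ Nv NvN v0; first by rewrite oppr_eq0.
by rewrite (eq0_of_neg_multiple c0 E) eqxx in v0.
Qed.

(** * Assembly of the equivalence *)

Theorem theorem2 (R : realType) (n m : nat) (K : set 'rV[R]_m)
  (h : 'rV[R]_n -> 'rV[R]_m) (xb : 'rV[R]_n) :
  smooth_cone K -> C1 h -> K_concave K h ->
  h @^-1` K !=set0 -> (h @^-1` K) xb ->
  (local_error_bound h K xb <->
   exists U, nbhs xb U /\ ACQ_on h K U).
Proof.
move=> sK ch vh _ Kxb; have [[cK _ clK vK _] _ _] := sK.
split=> [[U [xbU [alpha [alpha0 leb]]]]|[U [xbU acq]]]; last first.
  apply: bounded_multipliers_error_bound => //.
  exact: ACQ_bounded_multipliers xbU acq.
(* At an interior point of [U] the error bound holds on a whole neighbourhood. *)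
exists U°; split; first exact: nbhs_interior.
move=> x [Kx xU]; apply/seteqP; split=> [_ [w Nw <-]|v Nv].
  exact: jac_adj_normal_cone.
have lebx : \forall u \near x,
    dist_set u (h @^-1` K) <= alpha * dist_set (h u) K.
  by apply: filterS xU => u; exact: leb.
have [w Nw wv] := error_bound_multiplier cK vK clK ch alpha0 lebx Kx Nv.
by exists w.
Qed.
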